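(* Let $y_{h,\mathrm{ls}}^\star\in\mathbb{R}^{n_h}$ satisfy $S_h(y_{h,\mathrm{ls}}^\star)=0$, let $y_\theta,y_h^\pi\in\mathbb{R}^{n_h}$, and for each $y\in\{y_\theta,y_h^\pi\}$ assume that $K_h(y)$ is invertible, that $\|y-y_{h,\mathrm{ls}}^\star\|_{X_h}\le t_h^{\mathrm{ls}}(y)$, and that a bound $\mathcal R_h^{\mathrm{ls}}(y;t_h^{\mathrm{ls}}(y))\ge\|R_h^{\mathrm{ls}}(y;y-y_{h,\mathrm{ls}}^\star)\|_{X_h^\ast}$ is available. Put $s_h^\pi:=S_h(y_h^\pi)$ and assume $\varepsilon_{i,h}^{\mathrm{eval}}\ge|L_{i,h}(y_h^\pi)-u^\star(x_i)|$. Define $$\mu_{i,h}^{\mathrm{ls,disc}}:=\left|\bigl(q_{i,h}^{\mathrm{ls}}(y_h^\pi)\bigr)^\top s_h^\pi\right|+\|q_{i,h}^{\mathrm{ls}}(y_h^\pi)\|_{X_h}\,\mathcal R_h^{\mathrm{ls}}(y_h^\pi;t_h^{\mathrm{ls}}(y_h^\pi))+\varepsilon_{i,h}^{\mathrm{eval}},$$ $$c_{i,h}^{\mathrm{ls,corr}}:=L_{i,h}(y_\theta)-\bigl(q_{i,h}^{\mathrm{ls}}(y_\theta)\bigr)^\top S_h(y_\theta).$$ Then $$|c_{i,h}^{\mathrm{ls,corr}}-u^\star(x_i)|\le\rho_{i,h}^{\mathrm{ls}}:=\|q_{i,h}^{\mathrm{ls}}(y_\theta)\|_{X_h}\,\mathcal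 R_h^{\mathrm{ls}}(y_\theta;t_h^{\mathrm{ls}}(y_\theta))+\mu_{i,h}^{\mathrm{ls,disc}}.$$ Hence $u^\star(x_i)\in[c_{i,h}^{\mathrm{ls,corr}}-\rho_{i,h}^{\mathrm{ls}},\,c_{i,h}^{\mathrm{ls,corr}}+\rho_{i,h}^{\mathrm{ls}}]$. Moreover, $$|L_{i,h}(y_\theta)-u^\star(x_i)|\le\|q_{i,h}^{\mathrm{ls}}(y_\theta)\|_{X_h}\Bigl(\|S_h(y_\theta)\|_{X_h^\ast}+\mathcal R_h^{\mathrm{ls}}(y_\theta;t_h^{\mathrm{ls}}(y_\theta))\Bigr)+\mu_{i,h}^{\mathrm{ls,disc}},$$ and therefore $$|u_\theta(x_i)-u^\star(x_i)|\le\zeta_{i,h}^\theta+\|q_{i,h}^{\mathrm{ls}}(y_\theta)\|_{X_h}\Bigl(\|S_h(y_\theta)\|_{X_h^\ast}+\mathcal R_h^{\mathrm{ls}}(y_\theta;t_h^{\mathrm{ls}}(y_\theta))\Bigr)+\mu_{i,h}^{\mathrm{ls,disc}},$$ where $u_\theta(x_i)\in\mathbb{R}$ is an unprojected neural output and $\zeta_{i,h}^\theta:=|u_\theta(x_i)-L_{i,h}(y_\theta)|$.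
   Context: $u^\star$ is the exact solution (unique in its admissible class) of a boundary-value problem on a bounded domain $\Omega\subset\mathbb{R}^d$, with $u^\star(x_i)$ well defined at the query point $x_i\in\overline\Omega$. $\|\cdot\|_{X_h}$ is a fixed norm on $\mathbb{R}^{n_h}$ and $\|\cdot\|_{X_h^\ast}$ its dual norm, $\|s\|_{X_h^\ast}=\sup_{\|v\|_{X_h}\le1}|s^\top v|$. $W_h\in\mathbb{R}^{M_h\times M_h}$ is symmetric positive definite. $F_h:\mathbb{R}^{n_h}\to\mathbb{R}^{M_h}$ is twice continuously differentiable on the relevant neighborhood, $S_h(y):=DF_h(y)^\top W_hF_h(y)\in\mathbb{R}^{n_h}$ (the gradient of $\frac12F_h(y)^\top W_hF_h(y)$), and $K_h(y):=DS_h(y)$. Full vectors are $U(y):=U_{0,h}+Z_hy$ with $U_{0,h}\in\mathbb{R}^{N_h}$ and $Z_h\in\mathbb{R}^{N_h\times n_h}$ of full column rank; for the query vector $\ell_{i,h}\in\mathbb{R}^{N_h}$, $L_{i,h}(y):=\ell_{i,h}^\top U(y)$ and $\widehat\ell_{i,h}:=Z_h^\top\ell_{i,h}$. When $K_h(y)$ is invertible, $q_{i,h}^{\mathrm{ls}}(y)$ is defined by $K_h(y)^\top q_{i,h}^{\mathrm{ls}}(y)=\widehat\ell_{i,h}$. For $d\in\mathbb{R}^{n_h}$, $R_h^{\mathrm{ls}}(y;d):=S_h(y-d)-S_h(y)+K_h(y)d$. The quantities $t_h^{\mathrm{ls}}(y)$ and $\mathcal R_h^{\mathrm{ls}}(y;t_h^{\mathrm{ls}}(y))$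 are given nonnegative real numbers. *)

(* Defs.v *)
From HB Require Import structures.
From mathcomp Require Import all_boot all_order all_algebra.
From mathcomp Require Import all_classical all_reals all_analysis.

Set Implicit Arguments.
Unset Strict Implicit.
Unset Printing Implicit Defensive.

Import Order.TTheory GRing.Theory Num.Theory.
Import numFieldNormedType.Exports.

Local Open Scope classical_set_scope.
Local Open Scope ring_scope.

Definition bounded_domain (R : realType) (d : nat) (Omega : set 'cV[R]_d) : Prop :=
  [/\ Omega !=set0, open Omega, connected Omega & bounded_set Omega].

(* The space [V] of candidate functions is abstract, so that classical, weak and
   other solution concepts are all covered; [pde] and [bc] are the candidates
   that satisfy the equation in the domain and the boundary conditions. *)
Definition unique_solution (V : Type) (adm pde bc : set V) (u : V) : Prop :=
  (adm `&` pde `&` bc) u /\ forall v, (adm `&` pde `&` bc) v -> v = u.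

(* The Euclidean pairing u^T v. *)
Definition dotc (R : realType) (n : nat) (u v : 'cV[R]_n) : R :=
  (u^T *m v) 0 0.

Definition is_norm (R : realType) (n : nat) (nrm : 'cV[R]_n -> R) : Prop :=
  [/\ forall v w, nrm (v + w) <= nrm v + nrm w,
      forall (a : R) v, nrm (a *: v) = `|a| * nrm v
    & forall v, nrm v = 0 -> v = 0].

(* If [nrm] is a norm then the set below is nonempty and bounded (in finite
   dimension), so the real-valued [sup] is its genuine least upper bound. *)
Definition dual_norm (R : realType) (n : nat) (nrm : 'cV[R]_n -> R)
    (s : 'cV[R]_n) : R :=
  sup [set `|dotc s v| | v in [set v | nrm v <= 1]].

Definition spd (R : realType) (M : nat) (W : 'M[R]_M) : Prop :=
  W^T = W /\ forall v : 'cV[R]_M, v != 0 -> 0 < dotc v (W *m v).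

(* The m x n Jacobian matrix, i.e. the matrix of the differential acting on
   column vectors (the library's [jacobian] acts on row vectors). *)
Definition jacc (R : realType) (n m : nat) (f : 'cV[R]_n -> 'cV[R]_m)
    (y : 'cV[R]_n) : 'M[R]_(m, n) :=
  \matrix_(i < m, j < n) ('d f y (delta_mx j 0)) i 0.

Definition C1_on (R : realType) (n m : nat) (D : set 'cV[R]_n)
    (f : 'cV[R]_n -> 'cV[R]_m) : Prop :=
  forall y, D y -> differentiable f y /\ {for y, continuous (jacc f)}.

(* [f] is C^1 and each of its partial derivatives, a column of the Jacobian, is
   C^1 as well. *)
Definition C2_on (R : realType) (n m : nat) (D : set 'cV[R]_n)
    (f : 'cV[R]_n -> 'cV[R]_m) : Prop :=
  C1_on D f /\ forall j : 'I_n, C1_on D (fun y => col j (jacc f y)).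

Definition ls_gradient (R : realType) (n M : nat) (W : 'M[R]_M)
    (F : 'cV[R]_n -> 'cV[R]_M) (y : 'cV[R]_n) : 'cV[R]_n :=
  (jacc F y)^T *m W *m F y.

Definition newton_remainder (R : realType) (n : nat)
    (S : 'cV[R]_n -> 'cV[R]_n) (y dy : 'cV[R]_n) : 'cV[R]_n :=
  S (y - dy) - S y + jacc S y *m dy.

(* Main.v *)
Require Import Defs.
From HB Require Import structures.
From mathcomp Require Import all_boot all_order all_algebra.
From mathcomp Require Import all_classical all_reals all_analysis.
From mathcomp Require Import ring.

Import Order.TTheory GRing.Theory Num.Theory.
Import numFieldNormedType.Exports.

Local Open Scope classical_set_scope.
Local Open Scope ring_scope.

(** Since [S ystar = 0], the Newton remainder at [y] in the direction [y - ystar] is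
    [K y (y - ystar) - S y]. Pairing it with the dual weight [q y], which solves the transposed
    system with right-hand side [ellhat], gives the exact identity [L y - L ystar = q^T S y + q^T r]
    with [r] that remainder ([dual_weighted_error]). Only [q^T r] is not computable, and duality of
    norms bounds it by [normX q * Rbound] ([norm_dotc_le_bound]). The identity is used twice: at
    [ypi], where the evaluation error links it to the exact value and [mu_disc] bounds the
    discretization error [L ystar - ustar_xi]; and at [ytheta], where [c_corr] subtracts exactly
    [q^T S]. Triangle inequalities do the rest. The duality bound needs the real-valued [sup] in
    [dual_norm] to be a true supremum, which rests on equivalence of norms in finite dimension
    ([mx_norm_le_is_norm]). *)

Section Dotc.
Set Implicit Arguments.
Unset Strict Implicit.
Variables (R : realType) (n : nat).
Implicit Types u v w : 'cV[R]_n.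

Lemma dotcE u v : dotc u v = \sum_i u i 0 * v i 0.
Proof. by rewrite /dotc mxE; apply: eq_bigr => i _; rewrite mxE. Qed.

Lemma dotcDr u v w : dotc u (v + w) = dotc u v + dotc u w.
Proof. by rewrite /dotc mulmxDr mxE. Qed.

Lemma dotcNr u v : dotc u (- v) = - dotc u v.
Proof. by rewrite /dotc mulmxN mxE. Qed.

Lemma dotcZr a u v : dotc u (a *: v) = a * dotc u v.
Proof. by rewrite /dotc -scalemxAr mxE. Qed.

Lemma dotcC u v : dotc u v = dotc v u.
Proof. by rewrite !dotcE; apply: eq_bigr => i _; rewrite mulrC. Qed.

Lemma dotc_trmulmx m (A : 'M[R]_(m, n)) (x : 'cV[R]_m) v :
  dotc (A^T *m x) v = dotc x (A *m v).
Proof. by rewrite /dotc trmx_mul trmxK mulmxA. Qed.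

End Dotc.

Section DualNorm.
Set Implicit Arguments.
Unset Strict Implicit.
Variables (R : realType) (n : nat).
Implicit Types (nrm : 'cV[R]_n -> R) (s v w : 'cV[R]_n).

Lemma is_norm0 nrm : is_norm nrm -> nrm 0 = 0.
Proof. by case=> _ nZ _; rewrite -(scale0r 0) nZ normr0 mul0r. Qed.

Lemma is_normN nrm v : is_norm nrm -> nrm (- v) = nrm v.
Proof. by case=> _ nZ _; rewrite -scaleN1r nZ normrN1 mul1r. Qed.

Lemma is_norm_ge0 nrm v : is_norm nrm -> 0 <= nrm v.
Proof.
move=> nrmP; have [nD _ _] := nrmP.
by have := nD v (- v); rewrite subrr is_norm0// is_normN// -mulr2n pmulrn_lge0.
Qed.

Lemma is_norm_gt0 nrm v : is_norm nrm -> v != 0 -> 0 < nrm v.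
Proof.
move=> nrmP v0; have [_ _ n0] := nrmP.
by rewrite lt_def is_norm_ge0// andbT; apply: contra v0 => /eqP/n0->.
Qed.

Lemma is_norm_distC nrm v w : is_norm nrm -> nrm (v - w) = nrm (w - v).
Proof. by move=> nrmP; rewrite -(is_normN _ nrmP) opprB. Qed.

Lemma is_norm_lipschitz nrm v w : is_norm nrm ->
  `|nrm v - nrm w| <= nrm (v - w).
Proof.
move=> nrmP; have [nD _ _] := nrmP.
have nB x y : nrm x - nrm y <= nrm (x - y).
  by rewrite lerBlDr (le_trans _ (nD _ _))// subrK.
by rewrite ler_norml nB andbT lerNl opprB is_norm_distC.
Qed.

Lemma ler_coord_mx_norm (x : 'rV[R]_n) i : `|x 0 i| <= `|x|.
Proof.
rewrite [leRHS]/Num.norm /= mx_normrE.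
by apply/bigmax_geP; right => /=; exists (0, i).
Qed.

Lemma is_norm_le_mx_norm nrm : is_norm nrm ->
  exists2 C : R, 0 < C & forall x : 'rV[R]_n, nrm x^T <= C * `|x|.
Proof.
move=> nrmP; have [nD nZ _] := nrmP.
pose C := \sum_i nrm (delta_mx i 0).
(* The added 1 keeps the constant positive when [n = 0], where the sum is empty. *)
exists (1 + C) => [|x].
  by rewrite ltr_pwDl// sumr_ge0// => i _; exact: is_norm_ge0.
have -> : x^T = \sum_i x 0 i *: delta_mx i 0.
  apply/colP => k; rewrite summxE (bigD1 k)//= big1 => [|j jk].
    by rewrite !mxE !eqxx mulr1 addr0.
  by rewrite !mxE eq_sym (negbTE jk) mulr0.
rewrite mulrDl mul1r; apply: ler_wpDl => //; rewrite /C mulr_suml.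
elim/big_ind2 : _ => [|a b c d ab cd|i _]; first by rewrite is_norm0.
  by rewrite (le_trans (nD _ _))// lerD.
by rewrite nZ mulrC ler_wpM2l ?is_norm_ge0// ler_coord_mx_norm.
Qed.

(** The norm is Lipschitz for the sup norm. Row vectors are used to match the extreme value theorem
    [EVT_min_rV]. *)
Lemma is_norm_continuous nrm : is_norm nrm ->
  continuous (fun x : 'rV[R]_n => nrm x^T).
Proof.
move=> nrmP; have [C C0 nrmC] := is_norm_le_mx_norm nrmP.
move=> x; apply/(@cvgrPdist_lt _ _ _ _ (nbhs_filter x)) => e e0; near=> y.
rewrite (le_lt_trans (is_norm_lipschitz _ _ nrmP))// -linearB/=.
rewrite (le_lt_trans (nrmC _))// mulrC -ltr_pdivlMr//.
by near: y; apply: (@cvgr_dist_lt _ _ _ _ (nbhs_filter x) id x) => //; rewrite divr_gt0.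
Unshelve. all: by end_near. Qed.

(* The minimum of the norm over the compact unit sphere of the sup norm is
   positive. *)
Lemma mx_norm_le_is_norm nrm : is_norm nrm ->
  exists2 c : R, 0 < c & forall x : 'rV[R]_n, c * `|x| <= nrm x^T.
Proof.
move=> nrmP; have [_ nZ _] := nrmP.
pose A := [set x : 'rV[R]_n | `|x| = 1].
have AZ (x : 'rV[R]_n) : x != 0 -> A (`|x|^-1 *: x).
  by move=> x0; rewrite /A/= normrZ normfV normr_id mulVf// normr_eq0.
(* An empty sphere forces every vector to be 0 (the case [n = 0]), and any constant works. *)
have [[x0 Ax0]|A0] := pselect (A !=set0); last first.
  exists 1 => // x; have [->|/AZ Ax] := eqVneq x 0.
    by rewrite normr0 mulr0 trmx0 is_norm0.
  by exfalso; apply: A0; eexists; exact: Ax.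
have cA : compact A.
  apply: bounded_closed_compact.
    by exists 1; split=> // r r1 x /= ->; exact: ltW.
  rewrite (_ : A = (fun x => `|x|) @^-1` [set 1])//.
  by apply: preimage_closed; [move=> ? _; exact: norm_continuous|exact: closed_eq].
have [|c Ac cmin] := EVT_min_rV (ex_intro _ x0 Ax0) cA (f := fun x => nrm x^T).
  by apply: continuous_subspaceT; exact: is_norm_continuous.
exists (nrm c^T) => [|x].
  apply: is_norm_gt0 => //; apply/eqP => /(congr1 trmx).
  rewrite trmxK trmx0 => c0; move: Ac; rewrite inE /A/= c0 normr0.
  by move=> /esym/eqP; rewrite oner_eq0.
have [->|x_neq0] := eqVneq x 0; first by rewrite normr0 mulr0 trmx0 is_norm0.
have := cmin _ (mem_set (AZ _ x_neq0)).
by rewrite linearZ/= nZ normfV normr_id mulrC ler_pdivlMr ?normr_gt0.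
Qed.

(** The unit ball of [nrm] lies in the sup-norm ball of radius [c^-1], which bounds every coordinate
    of [v]. *)
Lemma dual_norm_has_sup nrm s : is_norm nrm ->
  has_sup [set `|dotc s v| | v in [set v | nrm v <= 1]].
Proof.
move=> nrmP; have [c c0 cP] := mx_norm_le_is_norm nrmP; split.
  by exists `|dotc s 0|; exists 0 => //=; rewrite is_norm0.
exists (\sum_i `|s i 0| * c^-1) => _ [v /= v1 <-].
rewrite dotcE; apply: le_trans (ler_norm_sum _ _ _) _.
apply: ler_sum => i _; rewrite normrM ler_wpM2l//.
have := ler_coord_mx_norm v^T i; rewrite mxE => /le_trans; apply.
by rewrite -div1r ler_pdivlMr// mulrC (le_trans (cP _))// trmxK.
Qed.

(** For nonzero [v], the normalized vector [(nrm v)^-1 *: v] competes in the supremum. *)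
Lemma dotc_le_dual_norm nrm s v : is_norm nrm ->
  `|dotc s v| <= nrm v * dual_norm nrm s.
Proof.
move=> nrmP; have [_ nZ _] := nrmP.
have [->|v0] := eqVneq v 0.
  by rewrite (is_norm0 nrmP) mul0r /dotc mulmx0 mxE normr0.
have nv := is_norm_gt0 nrmP v0.
have invE : `|(nrm v)^-1| = (nrm v)^-1 by rewrite gtr0_norm ?invr_gt0.
rewrite mulrC -ler_pdivrMr//; have [_ ub] := dual_norm_has_sup s nrmP.
apply: (ub_le_sup ub); exists ((nrm v)^-1 *: v) => /=.
  by rewrite nZ invE mulVf// gt_eqF.
by rewrite dotcZr normrM invE mulrC.
Qed.

(* With S ystar = 0 the Newton remainder at y, in the direction y - ystar, is
   K y (y - ystar) - S y; pairing it with the dual weight q turns the first term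
   into L y - L ystar. *)
Lemma dual_weighted_error (N : nat)
    (S : 'cV[R]_n -> 'cV[R]_n) (U0 : 'cV[R]_N) (Z : 'M[R]_(N, n))
    (ell : 'cV[R]_N) (q y ystar : 'cV[R]_n) :
  S ystar = 0 -> (jacc S y)^T *m q = Z^T *m ell ->
  dotc ell (U0 + Z *m y) - dotc ell (U0 + Z *m ystar)
    = dotc q (S y) + dotc q (newton_remainder S y (y - ystar)).
Proof.
move=> Sstar Kq.
rewrite /newton_remainder subKr Sstar sub0r !dotcDr dotcNr addNKr.
rewrite -(dotc_trmulmx (jacc S y)) Kq dotc_trmulmx mulmxBr !dotcDr dotcNr.
by rewrite opprD addrACA subrr add0r.
Qed.

Lemma norm_dotc_le_bound nrm (q r : 'cV[R]_n) (b : R) :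
  is_norm nrm -> dual_norm nrm r <= b -> `|dotc q r| <= nrm q * b.
Proof.
move=> nrmP rb; rewrite dotcC (le_trans (dotc_le_dual_norm _ _ nrmP))//.
by rewrite ler_wpM2l ?is_norm_ge0.
Qed.

End DualNorm.

Theorem theoremC4 (R : realType) (d n M N : nat)
    (Omega : set 'cV[R]_d)
    (V : Type) (adm pde bc : set V) (value : V -> 'cV[R]_d -> option R)
    (ustar : V) (xi : 'cV[R]_d) (ustar_xi : R)
    (normX : 'cV[R]_n -> R)
    (W : 'M[R]_M) (D : set 'cV[R]_n) (F : 'cV[R]_n -> 'cV[R]_M)
    (U0 : 'cV[R]_N) (Z : 'M[R]_(N, n)) (ell : 'cV[R]_N)
    (q : 'cV[R]_n -> 'cV[R]_n)
    (t : 'cV[R]_n -> R) (Rbound : 'cV[R]_n -> R -> R)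
    (ystar ytheta ypi : 'cV[R]_n)
    (eps_eval : R) (utheta : 'cV[R]_d -> R) :
  let S := ls_gradient W F in
  let K := jacc S in
  let L := fun y => dotc ell (U0 + Z *m y) in
  let ellhat := Z^T *m ell in
  let dualX := dual_norm normX in
  bounded_domain Omega ->
  unique_solution adm pde bc ustar ->
  closure Omega xi ->
  value ustar xi = Some ustar_xi ->
  is_norm normX ->
  spd W ->
  open D -> D ystar -> D ytheta -> D ypi -> C2_on D F ->
  \rank Z = n ->
  (forall y, K y \in unitmx -> (K y)^T *m q y = ellhat) ->
  S ystar = 0 ->
  (forall y, [set ytheta; ypi] y ->
    [/\ K y \in unitmx,
        0 <= t y,
        normX (y - ystar) <= t y,
        0 <= Rbound y (t y)
      & dualX (newton_remainder S y (y - ystar)) <= Rbound y (t y)]) ->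
  `|L ypi - ustar_xi| <= eps_eval ->
  let s_pi := S ypi in
  let mu_disc := `|dotc (q ypi) s_pi|
                 + normX (q ypi) * Rbound ypi (t ypi) + eps_eval in
  let c_corr := L ytheta - dotc (q ytheta) (S ytheta) in
  let rho := normX (q ytheta) * Rbound ytheta (t ytheta) + mu_disc in
  let zeta := `|utheta xi - L ytheta| in
  [/\ `|c_corr - ustar_xi| <= rho,
      ustar_xi \in `[c_corr - rho, c_corr + rho],
      `|L ytheta - ustar_xi|
        <= normX (q ytheta) * (dualX (S ytheta) + Rbound ytheta (t ytheta))
           + mu_disc
    & `|utheta xi - ustar_xi|
        <= zeta
           + normX (q ytheta) * (dualX (S ytheta) + Rbound ytheta (t ytheta))
           + mu_disc].
Proof.
move=> S K L ellhat dualX _ _ _ _ nrmP _ _ _ _ _ _ _ qP Sstar boundP evalP.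
move=> s_pi mu_disc c_corr rho zeta.
have [Kt _ _ _ Rt] := boundP ytheta (or_introl erefl).
have [Kp _ _ _ Rp] := boundP ypi (or_intror erefl).
have Et := dual_weighted_error (S := S) U0 Sstar (qP _ Kt).
have Ep := dual_weighted_error (S := S) U0 Sstar (qP _ Kp).
rewrite -/(L _) -/(L ystar) in Et Ep.
have rt := norm_dotc_le_bound (q ytheta) nrmP Rt.
have rp := norm_dotc_le_bound (q ypi) nrmP Rp.
(* The detour through [ypi] is needed because the evaluation error is controlled only there. *)
have disc : `|L ystar - ustar_xi| <= mu_disc.
  have -> : L ystar - ustar_xi
      = - (L ypi - L ystar) + (L ypi - ustar_xi) by ring.
  rewrite (le_trans (ler_normD _ _))// normrN Ep /mu_disc lerD//.
  by rewrite (le_trans (ler_normD _ _))// lerD.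
have corr : `|c_corr - ustar_xi| <= rho.
  have -> : c_corr - ustar_xi = (L ytheta - L ystar)
      - dotc (q ytheta) (S ytheta) + (L ystar - ustar_xi).
    by rewrite /c_corr; ring.
  (* The correction cancels the residual term of the identity, leaving the remainder term plus the
     discretization error. *)
  by rewrite Et [X in X - _]addrC addrK (le_trans (ler_normD _ _))// lerD.
have uncorr : `|L ytheta - ustar_xi|
    <= normX (q ytheta) * (dualX (S ytheta) + Rbound ytheta (t ytheta))
       + mu_disc.
  have -> : L ytheta - ustar_xi
      = (L ytheta - L ystar) + (L ystar - ustar_xi) by ring.
  rewrite Et (le_trans (ler_normD _ _))// lerD// mulrDr.
  rewrite (le_trans (ler_normD _ _))// lerD//.
  (* Without the correction the residual term survives; its bound is the dual norm of [S ytheta]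
     itself. *)
  exact: norm_dotc_le_bound.
split=> //.
  by rewrite in_itv/= -ler_distl distrC.
rewrite -addrA -(subrKA (L ytheta)) (le_trans (ler_normD _ _))//.
by rewrite lerD.
Qed.
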